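(* Let $S^1$ be the circle type and $\mathrm{base}:S^1$ its base point. Then $\Pi_1(S^1,\mathrm{base})\simeq\mathbb{Z}$: there are mutually inverse functions $\Pi_1(S^1,\mathrm{base})\to\mathbb{Z}$ and $\mathbb{Z}\to\Pi_1(S^1,\mathrm{base})$.
   Context: Computational paths: in Martin-Löf type theory, for terms $a,b:A$ a computational path $a=_s b:A$ is a finite composition of rewrites, each an application of an axiom or inference rule of the $\lambda\beta\eta$-equality theory of type theory. These include reflexivity $a=_{\rho}a$; symmetry, which from $a=_s b$ gives $b=_{\sigma(s)}a$; and transitivity, which from $a=_s b$ and $b=_t c$ gives $a=_{\tau(s,t)}c$. Paths are compared up to rw-equality $=_{rw}$: the reflexive, symmetric and transitive closure of the rewrite system $LND_{EQ}$-$TRS$, whose rules include $\sigma(\rho)\rhd\rho$, $\sigma(\sigma(r))\rhd r$, $\tau(r,\sigma(r))\rhd\rho$, $\tau(\sigma(r),r)\rhd\rho$, $\tau(r,\rho)\rhd r$, $\tau(\rho,r)\rhd r$, and $\tau(\tau(t,r),s)\rhd\tau(t,\tau(r,s))$. The circle $S^1$ is the type generated by a point $\mathrm{base}:S^1$ and a computational path $\mathrm{base}=_{loop}\mathrm{base}:S^1$. Its other paths are obtained from $loop$ by applying $\rho$, $\sigma$ and $\tau$. For a type $A$ and a point $a:A$, $\Pi_1(A,a)=\{[l]_{rw}\mid a=_l a:A\}$ is the set of rw-equivalence classes of computational paths from $a$ to $a$. Its operation is $r\circ s:=\tau(s,r)$. *)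

(* Defs.v *)
From Stdlib Require Import ZArith Relations Setoid Morphisms.

Set Implicit Arguments.

(* A type presented by its points and its generating computational paths. *)
Record ptype : Type := PType {
  point :> Type;
  gen : point -> point -> Type
}.

Inductive path (A : ptype) : A -> A -> Type :=
| axiom a b : gen A a b -> path A a b
| rho a : path A a a
| sigma a b : path A a b -> path A b a
| tau a b c : path A a b -> path A b c -> path A a c.

Arguments axiom {A a b} _.
Arguments rho {A} a.
Arguments sigma {A a b} _.
Arguments tau {A a b c} _ _.

(* One-step reduction of LND_EQ-TRS on paths built from rho, sigma and tau.
   The three congruence constructors close the rules under contexts. *)
Inductive rwstep (A : ptype) : forall a b : A, path A a b -> path A a b -> Prop :=
| rw_sr a : rwstep (sigma (rho a)) (rho a)
| rw_ss a b (r : path A a b) : rwstep (sigma (sigma r)) r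
| rw_tr a b (r : path A a b) : rwstep (tau r (sigma r)) (rho a)
| rw_tsr a b (r : path A a b) : rwstep (tau (sigma r) r) (rho b)
| rw_trr a b (r : path A a b) : rwstep (tau r (rho b)) r
| rw_tlr a b (r : path A a b) : rwstep (tau (rho a) r) r
| rw_tt a b c d (t : path A a b) (r : path A b c) (s : path A c d) :
    rwstep (tau (tau t r) s) (tau t (tau r s))
| rw_sigma a b (r r' : path A a b) :
    rwstep r r' -> rwstep (sigma r) (sigma r')
| rw_taul a b c (r r' : path A a b) (s : path A b c) :
    rwstep r r' -> rwstep (tau r s) (tau r' s)
| rw_taur a b c (r : path A a b) (s s' : path A b c) :
    rwstep s s' -> rwstep (tau r s) (tau r s').

Definition rweq (A : ptype) (a b : A) : path A a b -> path A a b -> Prop :=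
  clos_refl_sym_trans (path A a b) (@rwstep A a b).

Definition Pi1 (A : ptype) (a : A) : Type :=
  {C : path A a a -> Prop | exists l : path A a a, C = rweq l}.

Inductive circle_point : Type := base_point.

Inductive circle_gen : circle_point -> circle_point -> Type :=
| loop_gen : circle_gen base_point base_point.

Definition S1 : ptype := PType circle_gen.
Definition base : S1 := base_point.
Definition loop : path S1 base base := axiom (loop_gen : gen S1 base base).

(* LND_EQ-TRS has three further rules that involve only rho, sigma and tau;
   they are derivable from the rules above, so adding them to rwstep would
   not change rweq. *)

#[global] Instance rweq_equivalence (A : ptype) (a b : A) :
  Equivalence (@rweq A a b).
Proof.
split.
- intros r; apply rst_refl.
- intros r s; apply rst_sym.
- intros r s t; apply rst_trans.
Qed.

#[global] Instance sigma_proper (A : ptype) (a b : A) :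
  Proper (@rweq A a b ==> @rweq A b a) sigma.
Proof.
intros r r' H; induction H as [r r' H | r | r r' _ IH | r r' r'' _ IH1 _ IH2].
- apply rst_step, rw_sigma, H.
- reflexivity.
- symmetry; exact IH.
- etransitivity; eassumption.
Qed.

#[global] Instance tau_proper (A : ptype) (a b c : A) :
  Proper (@rweq A a b ==> @rweq A b c ==> @rweq A a c) tau.
Proof.
intros r r' Hr s s' Hs; transitivity (tau r' s).
- clear Hs; induction Hr as [r r' H | r | r r' _ IH | r r' r'' _ IH1 _ IH2].
  + apply rst_step, rw_taul, H.
  + reflexivity.
  + symmetry; exact IH.
  + etransitivity; eassumption.
- clear Hr; induction Hs as [s s' H | s | s s' _ IH | s s' s'' _ IH1 _ IH2].
  + apply rst_step, rw_taur, H.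
  + reflexivity.
  + symmetry; exact IH.
  + etransitivity; eassumption.
Qed.

Lemma rweq_step (A : ptype) (a b : A) (r s : path A a b) :
  rwstep r s -> rweq r s.
Proof. exact (rst_step _ _ r s). Qed.

Lemma rweq_tts (A : ptype) (a b c : A) (u : path A a b) (v : path A a c) :
  rweq (tau u (tau (sigma u) v)) v.
Proof.
rewrite <- (rweq_step (rw_tt u (sigma u) v)), (rweq_step (rw_tr u)).
apply rweq_step, rw_tlr.
Qed.

Lemma rweq_tst (A : ptype) (a b c : A) (u : path A a b) (v : path A b c) :
  rweq (tau (sigma u) (tau u v)) v.
Proof.
rewrite <- (rweq_step (rw_tt (sigma u) u v)), (rweq_step (rw_tsr u)).
apply rweq_step, rw_tlr.
Qed.

Lemma rweq_stss (A : ptype) (a b c : A) (r : path A a b) (s : path A b c) :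
  rweq (sigma (tau r s)) (tau (sigma s) (sigma r)).
Proof.
rewrite <- (rweq_tst (tau r s) (tau (sigma s) (sigma r))).
rewrite (rweq_step (rw_tt r s (tau (sigma s) (sigma r)))), rweq_tts.
rewrite (rweq_step (rw_tr r)); symmetry.
apply rweq_step, rw_trr.
Qed.

(* Main.v *)
(** The winding number sends [axiom], [rho], [sigma], [tau] to [1], [0], [-],
    [+]. Every rewrite rule becomes an identity of [Z], so it is constant on
    rw-classes. Conversely each path is rw-equal to the power of [loop] given
    by its winding number, because integer powers of a loop satisfy
    [r^(m+n) = tau r^m r^n] and [r^(-n) = sigma r^n] up to rw-equality. *)
Require Import Defs.
From Stdlib Require Import ZArith Lia.
From Stdlib Require Import ClassicalEpsilon FunctionalExtensionality.
From Stdlib Require Import PropExtensionality ProofIrrelevance.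

Section LoopPowers.

Variables (A : ptype) (a : A) (r : path A a a).

Definition zpow (n : Z) : path A a a :=
  match n with
  | Z0 => rho a
  | Zpos p => Pos.iter (tau r) (rho a) p
  | Zneg p => Pos.iter (tau (sigma r)) (rho a) p
  end.

Lemma zpow_succ (n : Z) : rweq (zpow (Z.succ n)) (tau r (zpow n)).
Proof.
destruct n as [|p|p].
- reflexivity.
- replace (Z.succ (Zpos p)) with (Zpos (Pos.succ p)) by lia.
  simpl; rewrite Pos.iter_succ; reflexivity.
(* The exponent -1 stands apart: its successor is [Z0], and [Pos.pred 1] is again [1]. *)
- destruct (Pos.eq_dec p 1) as [->|np].
  + simpl; symmetry; apply rweq_tts.
  + rewrite <- (Pos.succ_pred p np).
    replace (Z.succ (Zneg (Pos.succ (Pos.pred p)))) with (Zneg (Pos.pred p))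
      by lia.
    simpl; rewrite Pos.iter_succ; symmetry; apply rweq_tts.
Qed.

Lemma zpow_pred (n : Z) : rweq (zpow (Z.pred n)) (tau (sigma r) (zpow n)).
Proof.
rewrite <- (rweq_tst r (zpow (Z.pred n))), <- zpow_succ, Z.succ_pred.
reflexivity.
Qed.

Lemma zpow_add (m n : Z) : rweq (zpow (m + n)) (tau (zpow m) (zpow n)).
Proof.
induction m as [|m IH|m IH] using Z.peano_ind.
- symmetry; apply rweq_step, rw_tlr.
- rewrite Z.add_succ_l, !zpow_succ, IH.
  symmetry; apply rweq_step, rw_tt.
- rewrite Z.add_pred_l, !zpow_pred, IH.
  symmetry; apply rweq_step, rw_tt.
Qed.

(** Uniqueness of inverses: by [zpow_add], [zpow (- n)] is a right inverse of [zpow n]. *)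
Lemma zpow_opp (n : Z) : rweq (zpow (- n)) (sigma (zpow n)).
Proof.
rewrite <- (rweq_tst (zpow n) (zpow (- n))), <- zpow_add, Z.add_opp_diag_r.
apply rweq_step, rw_trr.
Qed.

End LoopPowers.

Arguments zpow {A a} r n.

Fixpoint winding (a b : S1) (p : path S1 a b) : Z :=
  match p with
  | axiom _ => 1
  | rho _ => 0
  | sigma q => - winding _ _ q
  | tau q s => winding _ _ q + winding _ _ s
  end.

Arguments winding {a b} p.

Lemma winding_rweq (a b : S1) (p q : path S1 a b) :
  rweq p q -> winding p = winding q.
Proof.
induction 1 as [p q H | | |]; try congruence.
induction H; simpl; lia.
Qed.

Lemma winding_zpow (n : Z) : winding (zpow loop n) = n.
Proof.
induction n as [|n IH|n IH] using Z.peano_ind.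
- reflexivity.
- rewrite (winding_rweq _ _ _ _ (zpow_succ _ _ loop n)).
  change (1 + winding (zpow loop n) = Z.succ n)%Z; lia.
- rewrite (winding_rweq _ _ _ _ (zpow_pred _ _ loop n)).
  change (- (1) + winding (zpow loop n) = Z.pred n)%Z; lia.
Qed.

(* Powers of [loop] with arbitrary endpoints, so that induction on paths,
   whose endpoints vary, can mention them. *)
Definition loop_power (a b : S1) (n : Z) : path S1 a b :=
  match a, b with base_point, base_point => zpow loop n end.

Lemma rweq_loop_power (a b : S1) (p : path S1 a b) :
  rweq p (loop_power a b (winding p)).
Proof.
induction p as [a b g | a | a b p IH | a b c p IHp q IHq]; simpl.
(* [zpow loop 1] is [tau loop (rho base)], so a unit rule is needed to reach [loop]. *)
- destruct g; symmetry; apply rweq_step, rw_trr.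
- destruct a; reflexivity.
- rewrite IH at 1; destruct a, b; symmetry; apply zpow_opp.
- rewrite IHp, IHq at 1; destruct a, b, c; symmetry; apply zpow_add.
Qed.

Definition rwclass {A : ptype} {a : A} (l : path A a a) : Pi1 A a :=
  exist _ (rweq l) (ex_intro _ l eq_refl).

(** A class is a predicate with an existence proof: extensionality identifies the predicates, proof
    irrelevance the proofs. *)
Lemma rwclass_eq (A : ptype) (a : A) (l m : path A a a) :
  rweq l m -> rwclass l = rwclass m.
Proof.
intros H; apply subset_eq_compat, functional_extensionality; intros x.
apply propositional_extensionality; rewrite H; reflexivity.
Qed.

Lemma rwclass_inj (A : ptype) (a : A) (l m : path A a a) :
  rwclass l = rwclass m -> rweq l m.
Proof.
intros H; apply (f_equal (@proj1_sig _ _)) in H; simpl in H.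
rewrite H; reflexivity.
Qed.

Lemma rwclass_surj (A : ptype) (a : A) (x : Pi1 A a) :
  exists l, rwclass l = x.
Proof.
destruct x as [C [l ->]]; exists l; reflexivity.
Qed.

Theorem theorem5p17 :
  exists (toInteger : Pi1 S1 base -> Z) (toPath : Z -> Pi1 S1 base),
    (forall x : Pi1 S1 base, toPath (toInteger x) = x) /\
    (forall n : Z, toInteger (toPath n) = n).
Proof.
(* Representatives exist only in [Prop], so choice extracts one; the winding number does not depend
   on which. *)
pose (rep x := constructive_indefinite_description _ (rwclass_surj S1 base x)).
exists (fun x => winding (proj1_sig (rep x))), (fun n => rwclass (zpow loop n)).
split.
- intros x; destruct (rep x) as [l <-]; simpl.
  symmetry; apply rwclass_eq, (rweq_loop_power base base l).
- intros n; destruct (rep (rwclass (zpow loop n))) as [l H]; simpl.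
  rewrite (winding_rweq _ _ _ _ (rwclass_inj _ _ _ _ H)); apply winding_zpow.
Qed.
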